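(* Let $\langle X,\mathcal{K}\rangle$ be an $S$-space. Then $\langle\mathcal{V}(X),\le\rangle$ is a complete lattice which is dually isomorphic to the lattice (under inclusion) of all congruences of the semilattice $\mathbf{S}(X)=\langle S(X),\cap,X\rangle$.
   Context: Topological spaces are pairs $\langle X,\mathcal{K}\rangle$ with $\mathcal{K}$ a subbase. $S(X)=\{U^c\colon U\in\mathcal{K}\}$, $C_\mathcal{K}(X)=\{\bigcap\mathcal{A}\colon\mathcal{A}\subseteq S(X)\}$ (subbasic closed subsets). For $Y\subseteq X$, $\mathcal{Z}\subseteq S(X)$ is a $Y$-family if for all $A,B\in\mathcal{Z}$ there exist $H\in S(X)$, $C\in\mathcal{Z}$ with $Y\subseteq H$, $A\cap H\subseteq C$, $B\cap H\subseteq C$. An $S$-space is $\langle X,\mathcal{K}\rangle$ with: (S1) $T_0$ and $X=\bigcup\mathcal{K}$; (S2) $\mathcal{K}$ consists of compact open sets, closed under finite unions, $\emptyset\in\mathcal{K}$; (S3) for $U,V\in\mathcal{K}$, $x\in U\cap V$, there are $W,D\in\mathcal{K}$ with $x\notin W$, $x\in D$, $D\subseteq(U\cap V)\cup W$; (S4) if $Y\in C_\mathcal{K}(X)$ and $\mathcal{J}\subseteq S(X)$ is a $Y$-family with $Y\cap A^c\neq\emptyset$ for all $A\in\mathcal{J}$ then $Y\cap\bigcap\{A^c\colon A\in\mathcal{J}\}\ne\emptyset$. For a family $\mathcal{F}$ of subsets of $X$ and $U\subseteq X$, $U^-_\mathcal{F}=\{Y\in\mathcal{F}\colon Y\cap U\neq\emptyset\}$.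 A lower-Vietoris-type family of $\langle X,\mathcal{K}\rangle$ is a family $\mathcal{F}$ of nonempty subbasic closed subsets such that $\langle\mathcal{F},\mathcal{M}_\mathcal{F}\rangle$ is an $S$-space, where $\mathcal{M}_\mathcal{F}=\{U^-_\mathcal{F}\colon U\in\mathcal{K}\}$. $\mathcal{V}(X)$ is the set of these, ordered by $\mathcal{F}_1\le\mathcal{F}_2$ iff for all $U,V\in\mathcal{K}$, $U^-_{\mathcal{F}_2}=V^-_{\mathcal{F}_2}$ implies $U^-_{\mathcal{F}_1}=V^-_{\mathcal{F}_1}$.
   Formalization: In (S4) the Y-family J is required to be nonempty (equivalently Y nonempty): since X is the union of K, the empty set is subbasic closed, so with J empty the condition as written would fail for every space and no S-space would exist. *)

(* Defs.v *)
From HB Require Import structures.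
From mathcomp Require Import all_boot all_order.
From mathcomp Require Import all_classical.
From mathcomp Require Import topology.

Set Implicit Arguments.
Unset Strict Implicit.
Unset Printing Implicit Defensive.

Local Open Scope classical_set_scope.

(* The set X carrying the topology whose subbase is K. *)
Definition subbase_space (X : choiceType) (K : set (set X)) : Type := X.

HB.instance Definition _ (X : choiceType) (K : set (set X)) :=
  Choice.on (subbase_space K).
HB.instance Definition _ (X : choiceType) (K : set (set X)) :=
  isSubBaseTopological.Build (subbase_space K) K id.

Definition subbasic_compl (X : Type) (K : set (set X)) : set (set X) :=
  [set ~` U | U in K].

(* The empty intersection is all of X. *)
Definition subbasic_closed (X : Type) (K : set (set X)) : set (set X) :=
  [set \bigcap_(A in AA) A | AA in [set AA | AA `<=` subbasic_compl K]].

Definition Y_family (X : Type) (K : set (set X)) (Y : set X)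
    (Z : set (set X)) : Prop :=
  Z `<=` subbasic_compl K /\
  forall A B, Z A -> Z B ->
    exists H C, [/\ subbasic_compl K H, Z C, Y `<=` H,
                    A `&` H `<=` C & B `&` H `<=` C].

(* The family J in S_space_S4 must be taken nonempty: set0 is always subbasic  *)
(* closed (X is covered by K), so the empty J would make the axiom false for   *)
(* every space.                                                                *)
Record S_space (X : choiceType) (K : set (set X)) : Prop := {
  S_space_T0 : kolmogorov_space (subbase_space K) ;
  S_space_cover : \bigcup_(U in K) U = [set: X] ;
  S_space_compact : forall U, K U -> compact (U : set (subbase_space K)) ;
  S_space_open : forall U, K U -> open (U : set (subbase_space K)) ;
  S_space_set0 : K set0 ;
  S_space_setU : forall U V, K U -> K V -> K (U `|` V) ;
  S_space_S3 : forall U V x, K U -> K V -> (U `&` V) x ->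
    exists W D, [/\ K W, K D, ~ W x, D x & D `<=` (U `&` V) `|` W] ;
  S_space_S4 : forall Y J, subbasic_closed K Y -> Y_family K Y J ->
    J !=set0 -> (forall A, J A -> Y `&` ~` A !=set0) ->
    Y `&` \bigcap_(A in J) ~` A !=set0
}.

(* Subsets of a family F are represented as sets over the subtype F. *)
Definition lower_hit (X : Type) (F : set (set X)) (U : set X) : set F :=
  [set Y : F | val Y `&` U !=set0].
Arguments lower_hit {X} F U.

Definition lower_hits (X : Type) (K : set (set X)) (F : set (set X)) :
    set (set F) :=
  [set lower_hit F U | U in K].
Arguments lower_hits {X} K F.

Definition lower_Vietoris_type (X : choiceType) (K : set (set X))
    (F : set (set X)) : Prop :=
  (forall Y, F Y -> subbasic_closed K Y /\ Y !=set0) /\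
  S_space (lower_hits K F).

Definition lower_Vietoris_families (X : choiceType) (K : set (set X)) : Type :=
  [set F | lower_Vietoris_type K F].

Definition lower_Vietoris_le (X : choiceType) (K : set (set X))
    (F1 F2 : lower_Vietoris_families K) : Prop :=
  forall U V, K U -> K V ->
    lower_hit (val F2) U = lower_hit (val F2) V ->
    lower_hit (val F1) U = lower_hit (val F1) V.

Record is_semilattice (T : Type) (A : set T) (meet : T -> T -> T) (one : T) :
    Prop := {
  semilattice_meet : forall a b, A a -> A b -> A (meet a b) ;
  semilattice_one : A one ;
  semilattice_assoc : forall a b c, A a -> A b -> A c ->
    meet a (meet b c) = meet (meet a b) c ;
  semilattice_comm : forall a b, A a -> A b -> meet a b = meet b a ;
  semilattice_idem : forall a, A a -> meet a a = a ;
  semilattice_unit : forall a, A a -> meet a one = a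
}.

(* Congruences of the semilattice with carrier A, as subsets of A x A;         *)
(* compatibility with the constant is reflexivity.                             *)
Record is_congruence (T : Type) (A : set T) (meet : T -> T -> T)
    (theta : set (T * T)) : Prop := {
  congruence_sub : theta `<=` A `*` A ;
  congruence_refl : forall a, A a -> theta (a, a) ;
  congruence_sym : forall a b, theta (a, b) -> theta (b, a) ;
  congruence_trans : forall a b c,
    theta (a, b) -> theta (b, c) -> theta (a, c) ;
  congruence_meet : forall a b c d,
    theta (a, b) -> theta (c, d) -> theta (meet a c, meet b d)
}.

Lemma subbasic_compl_semilattice (X : choiceType) (K : set (set X)) :
  S_space K -> is_semilattice (subbasic_compl K) setI [set: X].
Proof.
move=> SK; split=> [_ _ [U KU <-] [V KV <-]||a b c _ _ _|a b _ _|a _|a _].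
- by exists (U `|` V); [exact: S_space_setU|rewrite setCU].
- by exists set0; [exact: S_space_set0|rewrite setC0].
- by rewrite setIA.
- by rewrite setIC.
- by rewrite setIid.
- by rewrite setIT.
Qed.

Definition congruences (X : Type) (K : set (set X)) : Type :=
  [set theta | is_congruence (subbasic_compl K) setI theta].

Definition congruence_le (X : Type) (K : set (set X))
    (theta1 theta2 : congruences K) : Prop :=
  val theta1 `<=` val theta2.

Definition is_lub (T : Type) (le : T -> T -> Prop) (A : set T) (s : T) : Prop :=
  (forall a, A a -> le a s) /\
  (forall u, (forall a, A a -> le a u) -> le s u).

Record complete_lattice (T : Type) (le : T -> T -> Prop) : Prop := {
  complete_lattice_refl : forall a, le a a ;
  complete_lattice_anti : forall a b, le a b -> le b a -> a = b ;
  complete_lattice_trans : forall a b c, le a b -> le b c -> le a c ;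
  complete_lattice_lub : forall A : set T, exists s, is_lub le A s ;
  complete_lattice_glb : forall A : set T,
    exists s, is_lub (fun a b => le b a) A s
}.

Definition dually_isomorphic (T1 T2 : Type) (le1 : T1 -> T1 -> Prop)
    (le2 : T2 -> T2 -> Prop) : Prop :=
  exists2 f : T1 -> T2, bijective f &
    forall a b, le1 a b <-> le2 (f b) (f a).

(* Main.v *)
Require Import Defs.
From mathcomp Require Import all_boot all_order all_classical topology.

(** For a congruence theta of S(X), send each filter of S(X) that is the
    preimage of an irreducible filter of S(X)/theta to its intersection.  The
    resulting subsets form a lower-Vietoris-type family: it is a copy of the
    dual space of S(X)/theta.  Conversely a lower-Vietoris-type family F gives
    the congruence identifying A and B when the same members of F lie below A
    and below B; (S3) and (S4) for F say that its points are exactly the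
    irreducible filters of the quotient, which makes the two constructions
    mutually inverse.  The order on families is by definition reverse inclusion
    of congruences, and congruences are closed under intersection. *)

Set Implicit Arguments.
Unset Strict Implicit.
Unset Printing Implicit Defensive.

Local Open Scope classical_set_scope.

(** * Convergence, separation and compactness in terms of a subbase *)

Lemma subbase_open (X : choiceType) (K : set (set X)) U :
  K U -> open (U : set (subbase_space K)).
Proof.
move=> KU; exists [set U]; last by rewrite bigcup_set1.
by move=> _ ->; apply: (@finI_from1 _ _ K id).
Qed.

(** Basic open sets are finite intersections of members of [K], and a filter is closed under finite
    intersections. *)
Lemma subbase_cvg (X : choiceType) (K : set (set X))
    (F : set_system (subbase_space K)) (x : subbase_space K) :
  Filter F -> (forall U, K U -> U x -> F U) -> F --> x.
Proof.
move=> FF FK V; rewrite nbhsE => -[W [[B Bsub BW] Wx] WV].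
apply: (filterS WV); move: Wx; rewrite -BW => -[C BC Cx].
apply: (@filterS _ _ _ C); first by move=> y Cy; exists C.
have [D DK DC] := Bsub C BC; rewrite -DC in Cx *.
apply: filter_bigI => U DU; apply: FK; last exact: Cx.
by have := DK U DU; rewrite inE.
Qed.

(** If two points lie in the same members of [K], the neighbourhood filter of each converges to the
    other, so no neighbourhood of one can miss the other. *)
Lemma subbase_T0P (X : choiceType) (K : set (set X)) :
  kolmogorov_space (subbase_space K) <->
  forall x y : X, (forall U, K U -> U x <-> U y) -> x = y.
Proof.
split=> [T0 x y xy|sep x y].
  apply/eqP/negP => /negP /T0 [A].
  have cvg z w : (forall U, K U -> U z <-> U w) ->
      nbhs (z : subbase_space K) --> (w : subbase_space K).
    move=> zw; apply: subbase_cvg => U KU Uw.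
    by apply: open_nbhs_nbhs; split; [exact: subbase_open|apply/(zw U KU)].
  case=> -[]; rewrite !inE => nA; apply;
    apply: (@nbhs_singleton (subbase_space K)).
    by apply: (cvg y x) => // U KU; apply: iff_sym; exact: xy.
  by apply: (cvg x y).
move=> /eqP xy; apply: contrapT => nsep; apply: xy; apply: sep => U KU.
split=> Uz; apply: contrapT => Uw; apply: nsep; exists U.
  left; rewrite !inE; split=> //.
  by apply: open_nbhs_nbhs; split=> //; exact: subbase_open.
right; rewrite !inE; split=> //.
by apply: open_nbhs_nbhs; split=> //; exact: subbase_open.
Qed.

(** Let [U] be the complement of [B]. If no member of [G] is inside [B], the traces of [G] on the
    compact set [U] generate a proper filter; its cluster point lies in [U] and in every closed set
    of [G], hence in [B], which is absurd. *)
Lemma subbasic_compl_compact (X : choiceType) (K : set (set X))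
    (G : set (set X)) B :
  S_space K -> G `<=` subbasic_compl K -> G setT ->
  (forall A C, G A -> G C -> G (A `&` C)) -> subbasic_compl K B ->
  \bigcap_(A in G) A `<=` B -> exists2 A, G A & A `<=` B.
Proof.
move=> SK GS GT GI [U KU <-] GB; apply: contrapT => nG.
pose F : set_system (subbase_space K) := filter_from G (fun A => U `&` A).
have FF : ProperFilter F.
  apply: filter_from_proper; first apply: filter_from_filter.
  - by exists setT.
  - move=> A C GA GC; exists (A `&` C); first exact: GI.
    by move=> x [Ux [Ax Cx]].
  move=> A GA; apply: contrapT => UA0; apply: nG; exists A => // x Ax Ux.
  by apply: UA0; exists x.
have [|x [Ux xF]] := @S_space_compact _ _ SK U KU F.
  by exists setT => // x [].
apply: (GB x) Ux => A GA; apply: contrapT => nAx.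
have [V KV VA] := GS A GA.
have /xF : F (U `&` A) by exists A.
move=> /(_ (~` A)) []; last by move=> y [[_ Ay]]; apply.
by apply: open_nbhs_nbhs; split => //; rewrite -VA setCK; exact: subbase_open.
Qed.

(** * Filters modulo a congruence *)

Section SSpace.
Variables (X : choiceType) (K : set (set X)).
Hypothesis SK : S_space K.
Local Notation S := (subbasic_compl K).

Let SI A B : S A -> S B -> S (A `&` B).
Proof. exact: (semilattice_meet (subbasic_compl_semilattice SK)). Qed.

Let ST : S setT.
Proof. exact: (semilattice_one (subbasic_compl_semilattice SK)). Qed.

(** The order of the quotient semilattice, read on representatives. *)
Definition quotient_le (theta : set (set X * set X)) (A B : set X) : Prop :=
  theta (A `&` B, A).

(** Preimages in S(X) of filters of the quotient; working with preimages avoids forming the quotient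
    itself. *)
Record quotient_filter (theta : set (set X * set X)) (G : set (set X)) :
    Prop := {
  quotient_filter_sub : G `<=` S ;
  quotient_filterT : G setT ;
  quotient_filterI : forall A B, G A -> G B -> G (A `&` B) ;
  quotient_filterS : forall A B, quotient_le theta A B -> S B -> G A -> G B
}.

(** Elementwise form of being proper and not the intersection of two larger filters: two elements
    outside [G] have an upper bound modulo [G] that is still outside. *)
Definition irreducible_filter (theta : set (set X * set X))
    (G : set (set X)) : Prop :=
  [/\ quotient_filter theta G, (exists2 A, S A & ~ G A) &
      forall A B, S A -> S B -> ~ G A -> ~ G B ->
        exists H C, [/\ G H, S C, ~ G C,
          quotient_le theta (A `&` H) C & quotient_le theta (B `&` H) C]].

Definition irreducible_family (theta : set (set X * set X)) : set (set X) :=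
  [set \bigcap_(A in G) A | G in irreducible_filter theta].

(** * Boxes, the complements of hit sets, and the congruence of a family *)

Definition box (F : set (set X)) (A : set X) : set F :=
  [set Y : F | val Y `<=` A].
Arguments box : clear implicits.

Lemma boxE (F : set (set X)) A : box F A = ~` lower_hit F (~` A).
Proof.
apply/seteqP; split=> Y /=; first by move=> YA [x [Yx]]; apply; exact: YA.
by move=> nY x Yx; apply: contrapT => nAx; apply: nY; exists x.
Qed.

Lemma lower_hitE (F : set (set X)) U : lower_hit F U = ~` box F (~` U).
Proof. by rewrite boxE !setCK. Qed.

Lemma box_setI (F : set (set X)) A B : box F (A `&` B) = box F A `&` box F B.
Proof. by apply/seteqP; split=> Y; rewrite /box /= subsetI. Qed.

Lemma subbasic_compl_box (F : set (set X)) :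
  subbasic_compl (lower_hits K F) = [set box F A | A in S].
Proof.
apply/seteqP; split=> P [V [U KU <-] <-].
  exists (~` U); first by exists U.
  by rewrite boxE setCK.
exists (lower_hit F U); first by exists U.
by rewrite lower_hitE setCK.
Qed.

(** The kernel of [box F] on S(X); it is a congruence because boxes commute with intersections. *)
Definition hit_congruence (F : set (set X)) : set (set X * set X) :=
  [set AB | [/\ S AB.1, S AB.2 & box F AB.1 = box F AB.2]].

Lemma hit_congruenceP (F : set (set X)) :
  is_congruence S setI (hit_congruence F).
Proof.
split=> [[A B] []|a Sa|a b []|a b c [/= Sa Sb ab] [/= _ Sc bc]|] //=.
- by split=> //=; rewrite ab.
- move=> a b c d [/= Sa Sb ab] [/= Sc Sd cd].
  by split=> /=; [exact: SI|exact: SI|rewrite !box_setI ab cd].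
Qed.

Lemma hit_congruence_leP (F : set (set X)) A B : S A -> S B ->
  quotient_le (hit_congruence F) A B <-> box F A `<=` box F B.
Proof.
move=> SA SB; split=> [[_ _]|AB].
  by rewrite /= box_setI => <- Y [].
by split=> //=; [exact: SI|rewrite box_setI; apply/setIidPl].
Qed.

(** A subbasic closed set is the intersection of the members of S(X) that contain it. *)
Lemma subbasic_closed_inj Y Z : subbasic_closed K Y -> subbasic_closed K Z ->
  (forall A, S A -> Y `<=` A <-> Z `<=` A) -> Y = Z.
Proof.
move=> [AA AAS <-] [BB BBS <-] YZ.
apply/seteqP; split=> x Yx A AAA.
  by apply: (YZ A _).2 Yx => [|y]; [exact: BBS|apply].
by apply: (YZ A _).1 Yx => [|y]; [exact: AAS|apply].
Qed.

(** * Order and filters modulo a fixed congruence *)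

Section Quotient.
Variable theta : set (set X * set X).
Hypothesis Ctheta : is_congruence S setI theta.
Local Notation "A <=t B" := (quotient_le theta A B) (at level 70).

Lemma quotient_le_subset A B : S A -> A `<=` B -> A <=t B.
Proof.
move=> SA /setIidPl AB; rewrite /quotient_le AB.
exact: (congruence_refl Ctheta).
Qed.

Lemma quotient_le_trans B A C : S A -> S B -> S C ->
  A <=t B -> B <=t C -> A <=t C.
Proof.
move=> SA SB SC AB BC; have [_ trefl tsym ttrans tmeet] := Ctheta.
apply: ttrans (ttrans _ _ _ _ AB).
  apply: tmeet (trefl _ SC); exact: tsym AB.
by rewrite -setIA; apply: tmeet => //; exact: trefl.
Qed.

Lemma quotient_leI A B C D : A <=t B -> C <=t D -> A `&` C <=t B `&` D.
Proof.
move=> AB CD; rewrite /quotient_le setIACA.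
exact: (congruence_meet Ctheta).
Qed.

Lemma quotient_le_anti A B : A <=t B -> B <=t A -> theta (A, B).
Proof.
move=> AB; rewrite /quotient_le setIC => BA; have [_ _ tsym ttrans _] := Ctheta.
by apply: ttrans BA; exact: tsym.
Qed.

(** The chain condition for Zorn's lemma. The union of the empty chain is empty and is not a filter,
    so [G0] is adjoined throughout; the case [G = set0] below stands for [G0] alone. *)
Lemma quotient_filter_chain (G0 : set (set X))
    (F : set (set (set X))) :
  quotient_filter theta G0 ->
  F `<=` [set G | quotient_filter theta (G0 `|` G)] -> total_on F subset ->
  quotient_filter theta (G0 `|` \bigcup_(G in F) G).
Proof.
move=> G0f Ff Ftot.
have member A : (G0 `|` \bigcup_(G in F) G) A ->
    exists G, [/\ (G = set0 \/ F G) & (G0 `|` G) A].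
  case=> [G0A|[G FG GA]]; last by exists G; split; [right|right].
  by exists set0; split; left.
have sub G : G = set0 \/ F G ->
    G0 `|` G `<=` G0 `|` \bigcup_(G in F) G.
  by move=> [->|FG] A [G0A|//]; [left|left|move=> GA; right; exists G].
have filter G : G = set0 \/ F G -> quotient_filter theta (G0 `|` G).
  by move=> [->|/Ff //]; rewrite setU0.
split=> [A /member [G [/filter /quotient_filter_sub]]||A B|A B AB SB].
- exact.
- by left; exact: (quotient_filterT G0f).
- move=> /member [G [FG GA]] /member [H [FH HB]].
  suff [E [FE GE HE]] : exists E, [/\ E = set0 \/ F E, G `<=` E & H `<=` E].
    apply: (sub _ FE); apply: (quotient_filterI (filter _ FE)).
      by case: GA => [?|/GE ?]; [left|right].
    by case: HB => [?|/HE ?]; [left|right].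
  case: FG FH => [->|FG] [->|FH].
  + by exists set0; split=> //; left.
  + by exists H; split=> //; right.
  + by exists G; split=> //; right.
  + have [GH|HG] := Ftot _ _ FG FH.
      by exists H; split=> //; right.
    by exists G; split=> //; right.
- move=> /member [G [FG GA]]; apply: (sub _ FG).
  exact: (quotient_filterS (filter _ FG) AB).
Qed.

(** This is the filter generated by [G] and [C], used to contradict maximality. *)
Lemma quotient_filter_adjoin (G : set (set X)) C :
  quotient_filter theta G -> S C ->
  quotient_filter theta
    [set B | S B /\ exists2 H, G H & C `&` H <=t B].
Proof.
move=> Gf SC; have GS := quotient_filter_sub Gf.
split=> [A [] //||A B [SA [H GH HA]] [SB [I GI IB]]|A B AB SB [SA [H GH HA]]].
- split=> //; exists setT; first exact: (quotient_filterT Gf).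
  by apply: quotient_le_subset => //; exact: SI.
- split; first exact: SI.
  exists (H `&` I); first exact: (quotient_filterI Gf).
  by rewrite -[C]setIid setIACA; exact: quotient_leI.
- split=> //; exists H => //.
  by apply: quotient_le_trans HA AB => //; apply: SI => //; exact: GS.
Qed.

(* The filters disjoint from J have maximal elements above G0, and             *)
(* directedness of J modulo G0 makes these irreducible.                        *)
Lemma irreducible_filter_separation (G0 J : set (set X)) :
  quotient_filter theta G0 -> J `<=` S -> J !=set0 ->
  (forall A, J A -> ~ G0 A) ->
  (forall A B, J A -> J B -> exists H C,
     [/\ G0 H, J C, A `&` H <=t C & B `&` H <=t C]) ->
  exists G, [/\ irreducible_filter theta G, G0 `<=` G &
                forall A, J A -> ~ G A].
Proof.
move=> G0f JS [A0 JA0] JG0 Jdir.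
pose P (G : set (set X)) :=
  quotient_filter theta (G0 `|` G) /\ forall A, J A -> ~ G A.
have [F FP Ftot|M [[Mf MJ] Mmax]] := @Zorn_bigcup (set X) P.
  split; first by apply: quotient_filter_chain => // G /FP [].
  by move=> A JA [G /FP [_ GJ] /GJ]; apply.
pose G := G0 `|` M; have GS := quotient_filter_sub Mf.
have GJ A : J A -> ~ G A by move=> JA [|]; [exact: JG0|exact: MJ].
(* By maximality of [M], the filter generated by [G] and an outside element must meet [J]. *)
have adjoin C : S C -> ~ G C ->
    exists H D, [/\ G H, J D & C `&` H <=t D].
  move=> SC nGC; apply: contrapT => nCJ.
  pose G' := [set B | S B /\ exists2 H, G H & C `&` H <=t B].
  have GG' : G `<=` G'.
    move=> B GB; split; first exact: GS.
    exists B => //; apply: quotient_le_subset; last exact: subIsetr.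
    by apply: SI => //; exact: GS.
  have MG' : M `<` G'.
    split; first by move=> B MB; apply: GG'; right.
    move=> G'M; apply: nGC; right; apply: G'M; split=> //.
    exists setT; first exact: (quotient_filterT Mf).
    by apply: quotient_le_subset; [exact: SI|exact: subIsetl].
  apply: (Mmax G' MG'); split.
    rewrite (_ : G0 `|` G' = G'); first exact: quotient_filter_adjoin.
    by apply/setUidPr => B G0B; apply: GG'; left.
  by move=> A JA [_ [H GH CHA]]; apply: nCJ; exists H, A.
exists G; split=> //; last by move=> A; left.
split=> //; first by exists A0; [exact: JS|exact: GJ].
move=> A B SA SB /(adjoin _ SA) [HA [DA [GHA JDA AD]]].
move=> /(adjoin _ SB) [HB [DB [GHB JDB BD]]].
have [H [C [G0H JC DAC DBC]]] := Jdir _ _ JDA JDB.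
have GH : G H by left.
have [SHA SHB SH] := And3 (GS _ GHA) (GS _ GHB) (GS _ GH).
have [SDA SDB SC] := And3 (JS _ JDA) (JS _ JDB) (JS _ JC).
have GHH : G (HA `&` HB `&` H).
  by apply: (quotient_filterI Mf) => //; exact: (quotient_filterI Mf).
have reduce E HE DE : S E -> S HE -> S DE -> E `&` HE <=t DE ->
    DE `&` H <=t C -> HA `&` HB `<=` HE -> E `&` (HA `&` HB `&` H) <=t C.
  move=> SE SHE SDE ED DC HHE.
  have SEHE := SI SE SHE; have SEHEH := SI SEHE SH.
  apply: (@quotient_le_trans (E `&` HE `&` H)) => //.
  - by apply: SI => //; exact: GS.
  - apply: quotient_le_subset; first by apply: SI => //; exact: GS.
    by rewrite -[X in _ `<=` X]setIA; apply: setIS; exact: setSI.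
  apply: (@quotient_le_trans (DE `&` H)) => //; first exact: SI.
  by apply: quotient_leI => //; exact: quotient_le_subset.
exists (HA `&` HB `&` H), C; split=> //; first exact: GJ.
  exact: reduce AD DAC (@subIsetl _ _ _).
exact: reduce BD DBC (@subIsetr _ _ _).
Qed.

(** Compactness makes a filter recoverable from its intersection, so filters may be replaced by
    subsets of [X] without loss. *)
Lemma quotient_filter_bigcap (G : set (set X)) B :
  quotient_filter theta G -> S B -> \bigcap_(A in G) A `<=` B <-> G B.
Proof.
move=> Gf SB; split=> [GB|GB x]; last by apply.
have [||A GA AB] :=
    subbasic_compl_compact SK (quotient_filter_sub Gf) _ _ SB GB.
- exact: (quotient_filterT Gf).
- by move=> A C; exact: (quotient_filterI Gf).
apply: (quotient_filterS Gf _ SB GA); apply: quotient_le_subset => //.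
exact: (quotient_filter_sub Gf).
Qed.

(** * The family of irreducible filters as an S-space *)

Local Notation F := (irreducible_family theta).

Lemma irreducible_familyP (Y : F) : exists2 G, irreducible_filter theta G &
  forall A, S A -> box F A Y <-> G A.
Proof.
have [G Girr GY] := set_valP Y; exists G => // A SA.
by rewrite /box /= -GY; apply: quotient_filter_bigcap => //; case: Girr.
Qed.

Lemma irreducible_family_point (G : set (set X)) : irreducible_filter theta G ->
  exists Y : F, forall A, S A -> box F A Y <-> G A.
Proof.
move=> Girr; have FG : F (\bigcap_(A in G) A) by exists G.
exists (SigSub (mem_set FG)) => A SA.
by apply: quotient_filter_bigcap => //; case: Girr.
Qed.

(** If [A] is not below [B], the principal filter of [A] and the singleton of [B] are separated by
    an irreducible filter, which is a point of the first box outside the second. *)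
Lemma quotient_le_box A B : S A -> S B ->
  A <=t B <-> box F A `<=` box F B.
Proof.
move=> SA SB; split=> [AB Y|AB].
  have [G [Gf _ _] YG] := irreducible_familyP Y.
  by move=> /(YG _ SA) GA; apply/(YG _ SB); exact: (quotient_filterS Gf AB).
apply: contrapT => nAB.
pose G0 := [set C | S C /\ A <=t C].
have [|C -> //||D GD|D E -> ->|G [Girr G0G GB]] :=
    @irreducible_filter_separation G0 [set B].
- split=> [C []//||C D [SC AC] [SD AD]|C D CD SD [SC AC]].
  + by split=> //; exact: quotient_le_subset.
  + by split; [exact: SI|rewrite -[A]setIid; exact: quotient_leI].
  + by split=> //; exact: quotient_le_trans AC CD.
- by exists B.
- by rewrite GD => -[].
- exists setT, B; split=> //; last 2 first.
  + by rewrite setIT; exact: quotient_le_subset.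
  + by rewrite setIT; exact: quotient_le_subset.
  by split=> //; exact: quotient_le_subset.
have [Y YG] := irreducible_family_point Girr.
apply: (GB B) => //; apply/(YG _ SB)/AB/(YG _ SA)/G0G.
by split=> //; exact: quotient_le_subset.
Qed.

(** A congruence is determined by its quotient order, which boxes represent by inclusion. *)
Lemma hit_congruence_irreducible_family : hit_congruence F = theta.
Proof.
apply/seteqP; split=> -[A B] /=.
  move=> [/= SA SB AB]; apply: quotient_le_anti; apply/quotient_le_box => //.
    by rewrite AB.
  by rewrite AB.
move=> AB; have [/= SA SB] := congruence_sub Ctheta AB.
have [_ trefl tsym _ tmeet] := Ctheta.
split=> //=; apply/seteqP; split; apply/quotient_le_box => //.
  by have := tmeet _ _ _ _ (trefl _ SA) (tsym _ _ AB); rewrite setIid.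
by have := tmeet _ _ _ _ (trefl _ SB) AB; rewrite setIid.
Qed.

(** Nonemptiness comes from properness: an empty intersection lies inside every [B], which would put
    every [B] in the filter. *)
Lemma irreducible_family_closed Y : F Y -> subbasic_closed K Y /\ Y !=set0.
Proof.
move=> [G [Gf [B SB nGB] _] <-]; split.
  by exists G => //; exact: (quotient_filter_sub Gf).
apply: contrapT => Y0; apply: nGB; apply/(quotient_filter_bigcap Gf SB) => x Yx.
by case: Y0; exists x.
Qed.

(** For an ultrafilter on the complement of the box of [B], the sets whose box it contains form a
    filter without [B]. An irreducible filter extending it and avoiding [B] is a limit. *)
Lemma irreducible_family_compact B : S B ->
  compact (~` box F B : set (subbase_space (lower_hits K F))).
Proof.
move=> SB; rewrite compact_ultra => U UU UB.
pose G0 := [set A | S A /\ U (box F A)].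
have [|C -> //||D ->|D E -> ->|G [Girr G0G GB]] :=
    @irreducible_filter_separation G0 [set B].
- split=> [C []//||C D [SC UC] [SD UD]|C D CD SD [SC UC]].
  + by split=> //; apply: filterS filterT.
  + by split; [exact: SI|rewrite box_setI; exact: filterI].
  + by split=> //; apply: filterS UC; apply/quotient_le_box.
- by exists B.
- move=> [_ UBB]; apply: (@filter_not_empty _ U).
  by rewrite -(setICl (box F B)); exact: filterI.
- exists setT, B; split=> //.
  + by split=> //; apply: filterS filterT.
  + by rewrite setIT; exact: quotient_le_subset.
  + by rewrite setIT; exact: quotient_le_subset.
have [Y YG] := irreducible_family_point Girr.
exists Y; split; first by move=> /(YG _ SB); exact: GB.
apply: subbase_cvg => _ [V KV <-]; rewrite lower_hitE => YV.
have SV : S (~` V) by exists V.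
have [UV|//] := in_ultra_setVsetC (box F (~` V)) UU.
by case: YV; apply/(YG _ SV)/G0G.
Qed.

Lemma irreducible_family_S_space : S_space (lower_hits K F).
Proof.
have SC U : K U -> S (~` U) by exists U.
split.
- apply/subbase_T0P => Y Z YZ; apply/val_inj.
  apply: subbasic_closed_inj => [||A [U KU UA]].
  + exact: (irreducible_family_closed (set_valP Y)).1.
  + exact: (irreducible_family_closed (set_valP Z)).1.
  have KFU : lower_hits K F (lower_hit F U) by exists U.
  have := YZ _ KFU; rewrite lower_hitE UA /setC /box /= => YZA.
  by split=> YA; apply: contrapT; [move/YZA.2|move/YZA.1]; apply.
- apply/seteqP; split=> // Y _.
  have [_ [y Yy]] := irreducible_family_closed (set_valP Y).
  have : [set: X] y by []; rewrite -(S_space_cover SK) => -[U KU Uy].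
  by exists (lower_hit F U); [exists U|exists y].
- move=> _ [U KU <-]; rewrite lower_hitE.
  by apply: irreducible_family_compact; exact: SC.
- by move=> P KP; exact: subbase_open.
- exists set0; first exact: S_space_set0.
  by apply/seteqP; split=> Y // [x []].
- move=> _ _ [U KU <-] [V KV <-]; exists (U `|` V); first exact: S_space_setU.
  by rewrite !lower_hitE setCU box_setI setCI.
(* (S3) is irreducibility of the filter of [Y]: the excluded set comes from [H] inside the filter,
   the neighbourhood of [Y] from [C] outside it. *)
- move=> _ _ Y [U KU <-] [V KV <-]; rewrite !lower_hitE => -[YU YV].
  have [G [Gf _ Girr] YG] := irreducible_familyP Y.
  have [||H [C [GH SC' nGC UC VC]]] := Girr _ _ (SC _ KU) (SC _ KV).
  + by move/(YG _ (SC _ KU)).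
  + by move/(YG _ (SC _ KV)).
  have SH := quotient_filter_sub Gf GH.
  have hit A : S A -> lower_hits K F (~` box F A).
    by move=> [W KW <-]; exists W => //; rewrite lower_hitE.
  exists (~` box F H), (~` box F C); split; [exact: hit|exact: hit| | |].
  + by move=> nYH; apply/nYH/(YG _ SH).
  + by move/(YG _ SC').
  move=> Z nZC; have [ZH|] := pselect (box F H Z); last by right.
  left; split=> ZA; apply: nZC.
    by apply: (quotient_le_box (SI (SC _ KU) SH) SC').1 UC _ _; rewrite box_setI.
  by apply: (quotient_le_box (SI (SC _ KV) SH) SC').1 VC _ _; rewrite box_setI.
(* (S4) is separation: [G0] is the filter of sets whose box contains the closed set [Q], and the
   Y-family condition is directedness of [J'] modulo [G0]. *)
- move=> P J [PP]; rewrite /Y_family subbasic_compl_box => PPS <- [JS Jdir].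
  set Q := \bigcap_(A in PP) A => -[B0 JB0] QJ.
  pose G0 := [set A | S A /\ Q `<=` box F A].
  pose J' := [set A | S A /\ J (box F A)].
  have [||||A B [SA JA] [SB JB]|G [Girr G0G GJ]] :=
      @irreducible_filter_separation G0 J'.
  + split=> [A []//||A B [SA QA] [SB QB]|A B AB SB [SA QA]].
    * by split.
    * by split; [exact: SI|rewrite box_setI subsetI].
    * by split=> //; apply: subset_trans QA _; apply/quotient_le_box.
  + by move=> A [].
  + by have [A SA AB] := JS _ JB0; exists A; split=> //; rewrite AB.
  + by move=> A [_ /QJ [Y [QY nAY]]] [_ /(_ Y QY)].
  + have [P1 [P2 [[H SH HE] JC]]] := Jdir _ _ JA JB; rewrite -{}HE => QH AC BC.
    have [C SC' CE] := JS _ JC; rewrite -CE in JC AC BC.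
    exists H, C; split=> //.
      by apply/quotient_le_box => //; [exact: SI|rewrite box_setI].
    by apply/quotient_le_box => //; [exact: SI|rewrite box_setI].
  have [Y YG] := irreducible_family_point Girr.
  exists Y; split.
    move=> A PPA; have [B SB BA] := PPS _ PPA; rewrite -BA.
    apply/(YG _ SB)/G0G; split=> // Z; rewrite BA; exact.
  move=> A JA; have [B SB BA] := JS _ JA; rewrite -BA.
  by move/(YG _ SB); apply: GJ; split=> //; rewrite BA.
Qed.

End Quotient.

(** * Recovering a family from its congruence *)

Lemma irreducible_family_hit_congruence (F : set (set X)) :
  lower_Vietoris_type K F -> irreducible_family (hit_congruence F) = F.
Proof.
move=> [Fcl SF].
have SFS : subbasic_compl (lower_hits K F) = [set box F A | A in S].
  exact: subbasic_compl_box.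
apply/seteqP; split=> Y.
  move=> [G [Gf [B SB nGB] Girr] <-].
  have GS := quotient_filter_sub Gf.
  (* By irreducibility, the boxes of sets outside [G] form a [Q]-family; (S4) then yields a member
     of [F] contained in exactly those sets of S(X) that belong to [G]. *)
  pose Q := \bigcap_(A in G) box F A.
  pose J := [set box F A | A in S `\` G].
  have [|||P [A [SA nGA] <-]|Z [QZ JZ]] := @S_space_S4 _ _ SF Q J.
  - exists [set box F A | A in G]; last by rewrite bigcap_image.
    by rewrite SFS => P [A /GS SA <-]; exists A.
  - rewrite /Y_family SFS; split; first by move=> P [A [SA _] <-]; exists A.
    move=> P P' [A [SA nGA] <-] [C [SC nGC] <-].
    have [H [D [GH SD nGD AD CD]]] := Girr _ _ SA SC nGA nGC.
    have SH := GS _ GH.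
    exists (box F H), (box F D); split.
    + by exists H.
    + by exists D.
    + by move=> Z; apply.
    + by rewrite -box_setI; apply/hit_congruence_leP => //; exact: SI.
    + by rewrite -box_setI; apply/hit_congruence_leP => //; exact: SI.
  - by exists (box F B); exists B.
  (* If [Q] lay inside the box of [A], compactness in the space [F] would give a single [C] in [G]
     whose box lies inside it, forcing [A] into [G]. *)
  - apply: contrapT => QA0; apply: nGA.
    have [|||||_ [C GC <-] CA] :=
        @subbasic_compl_compact _ _ [set box F C | C in G] (box F A) SF.
    + by rewrite SFS => P' [C /GS SC <-]; exists C.
    + exists setT; first exact: (quotient_filterT Gf).
      by apply/seteqP; split.
    + move=> _ _ [C GC <-] [D GD <-]; exists (C `&` D); last exact: box_setI.
      exact: (quotient_filterI Gf).
    + by rewrite SFS; exists A.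
    + rewrite bigcap_image => Z QZ; apply: contrapT => nAZ.
      by apply: QA0; exists Z.
    apply: (quotient_filterS Gf _ SA GC).
    by apply/hit_congruence_leP => //; exact: GS.
  rewrite (_ : \bigcap_(A in G) A = val Z); first exact: set_valP.
  apply: subbasic_closed_inj; first by exists G.
    exact: (Fcl _ (set_valP Z)).1.
  move=> A SA; rewrite (quotient_filter_bigcap (hit_congruenceP F) Gf SA).
  split=> [GA|ZA]; first exact: QZ.
  by apply: contrapT => nGA; apply: (JZ (box F A)) => //; exists A.
move=> FY; have [Ycl [y Yy]] := Fcl _ FY.
pose Z : F := SigSub (mem_set FY).
(* Conversely, the filter of sets containing [Y] is proper since some member of [K] meets [Y], and
   irreducible by (S3) at [Z]. *)
pose G := [set A | S A /\ box F A Z].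
exists G.
  split.
  - split=> [A []//||A B [SA ZA] [SB ZB]|A B AB SB [SA ZA]].
    + by split.
    + by split; [exact: SI|rewrite box_setI].
    + by split=> //; apply: (hit_congruence_leP F SA SB).1 ZA.
  - have : [set: X] y by []; rewrite -(S_space_cover SK) => -[U KU Uy].
    by exists (~` U); [exists U|move=> [_ /(_ y Yy)]].
  - move=> _ _ [U KU <-] [V KV <-] nU nV.
    have hit W : K W -> ~ G (~` W) -> lower_hit F W Z.
      move=> KW nW; rewrite lower_hitE => ZW; apply: nW; split=> //.
      by exists W.
    have [|||_ [_ [[W KW <-] [D KD <-] nWZ DZ UVD]]] :=
        @S_space_S3 _ _ SF (lower_hit F U) (lower_hit F V) Z.
    + by exists U.
    + by exists V.
    + by split; exact: hit.
    have SC T : K T -> S (~` T) by exists T.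
    exists (~` W), (~` D); split.
    + by split; [exact: SC|rewrite boxE setCK].
    + exact: SC.
    + by move=> [_]; rewrite boxE setCK; apply.
    + apply/hit_congruence_leP; [exact: SI (SC _ KU) (SC _ KW)|exact: SC|].
      rewrite -setCU !boxE !setCK; apply: subsetC => T /UVD [[TU _]|TW].
        by case: TU => x [Tx Ux]; exists x; split=> //; left.
      by case: TW => x [Tx Ux]; exists x; split=> //; right.
    + apply/hit_congruence_leP; [exact: SI (SC _ KV) (SC _ KW)|exact: SC|].
      rewrite -setCU !boxE !setCK; apply: subsetC => T /UVD [[_ TV]|TW].
        by case: TV => x [Tx Vx]; exists x; split=> //; left.
      by case: TW => x [Tx Ux]; exists x; split=> //; right.
apply/seteqP; split=> [x Gx|x Yx A [_]]; last exact.
have [AA AAS AAY] := Ycl; rewrite -AAY => A AAA; apply: Gx.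
split; first exact: AAS.
by rewrite /box /= -AAY => z; apply.
Qed.

(** * The bijection and the two orders *)

Lemma lower_Vietoris_type_irreducible theta :
  is_congruence S setI theta ->
  lower_Vietoris_type K (irreducible_family theta).
Proof.
move=> Ctheta; split; last exact: irreducible_family_S_space.
by move=> Y; exact: irreducible_family_closed.
Qed.

Lemma hit_congruence_bijective :
  bijective (fun F : lower_Vietoris_families K =>
    SigSub (mem_set (hit_congruenceP (val F))) : congruences K).
Proof.
exists (fun theta : congruences K =>
  SigSub (mem_set (lower_Vietoris_type_irreducible (set_valP theta)))).
  move=> F; apply: val_inj => /=.
  exact: (irreducible_family_hit_congruence (set_valP F)).
move=> theta; apply: val_inj => /=.
exact: (hit_congruence_irreducible_family (set_valP theta)).
Qed.

(** Complementation exchanges hit sets of members of [K] with boxes of members of S(X). *)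
Lemma lower_Vietoris_leE (F1 F2 : lower_Vietoris_families K) :
  lower_Vietoris_le F1 F2 <->
  hit_congruence (val F2) `<=` hit_congruence (val F1).
Proof.
split=> [le12 [A B] [[U KU /= <-] [V KV /= <-] UV]|sub21 U V KU KV UV].
  split=> /=; [by exists U|by exists V|].
  rewrite !boxE !setCK; congr (~` _); apply: le12 => //.
  by rewrite !lower_hitE UV.
have [|_ _ /=] := sub21 (~` U, ~` V); last by rewrite !lower_hitE => ->.
by split=> /=; [exists U|exists V|rewrite !boxE !setCK UV].
Qed.

Lemma congruence_glb (A : set (congruences K)) :
  exists s, is_lub (fun a b => congruence_le b a) A s.
Proof.
(* Restricting to pairs from [S] makes the empty collection yield the total congruence. *)
pose theta := [set x | (S `*` S) x /\ forall t, A t -> val t x].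
have Ct (t : congruences K) : is_congruence S setI (val t) := set_valP t.
have Ctheta : is_congruence S setI theta.
  split=> [x []//|a Sa|a b [[Sa Sb] ab]|a b c [[Sa _] ab] [[_ Sc] bc]|].
  - by split=> // t _; exact: (congruence_refl (Ct t)).
  - by split=> // t At; apply: (congruence_sym (Ct t)); exact: ab.
  - split=> // t At; apply: (congruence_trans (Ct t)); first exact: ab.
    exact: bc.
  - move=> a b c d [[/= Sa Sb] ab] [[/= Sc Sd] cd].
    split; first by split; exact: SI.
    by move=> t At; apply: (congruence_meet (Ct t)); [exact: ab|exact: cd].
exists (SigSub (mem_set Ctheta)); split=> [t At x [_]|u uA x ux]; first exact.
split; first exact: (congruence_sub (Ct u)).
by move=> t At; exact: (uA t At).
Qed.

End SSpace.

Lemma complete_lattice_dual (T1 T2 : Type) (le1 : T1 -> T1 -> Prop)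
    (le2 : T2 -> T2 -> Prop) :
  dually_isomorphic le1 le2 ->
  (forall a, le2 a a) -> (forall a b, le2 a b -> le2 b a -> a = b) ->
  (forall a b c, le2 a b -> le2 b c -> le2 a c) ->
  (forall A, exists s, is_lub (fun a b => le2 b a) A s) ->
  complete_lattice le1.
Proof.
move=> [f [g fK gK] fle] refl2 anti2 trans2 glb2.
have lub A : exists s, is_lub le1 A s.
  have [s [sA smax]] := glb2 [set f a | a in A].
  exists (g s); split=> [a Aa|u uA]; apply/fle; rewrite gK.
    by apply: sA; exists a.
  by apply: smax => _ [a Aa <-]; apply/fle/uA.
split=> // [a|a b /fle ba /fle ab|a b c /fle ba /fle cb|A].
- exact/fle.
- by rewrite -[a]fK -[b]fK; congr g; exact: anti2.
- by apply/fle; exact: trans2 cb ba.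
(* A greatest lower bound is obtained as the least upper bound of all lower bounds. *)
- have [s [sA smin]] := lub [set u | forall a, A a -> le1 u a].
  by exists s; split=> [a Aa|u uA]; [apply: smin => u; apply|exact: sA].
Qed.

Theorem theorem15 (X : choiceType) (K : set (set X)) (SK : S_space K) :
  complete_lattice (@lower_Vietoris_le X K) /\
  dually_isomorphic (@lower_Vietoris_le X K) (@congruence_le X K).
Proof.
suff iso : dually_isomorphic (@lower_Vietoris_le X K) (@congruence_le X K).
  split=> //; apply: complete_lattice_dual iso _ _ _ _.
  - by move=> a x.
  - by move=> a b ab ba; apply/val_inj/seteqP.
  - by move=> a b c ab bc; exact: subset_trans ab bc.
  - exact: congruence_glb.
exists (fun F : lower_Vietoris_families K =>
  SigSub (mem_set (hit_congruenceP SK (val F)))).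
  exact: hit_congruence_bijective.
by move=> F1 F2; exact: lower_Vietoris_leE.
Qed.
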